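(* Let $\Bbbk$ be a field, $\mathcal A$ a quiver over a non-empty set $\mathcal P$, $\sigma:\mathcal A\,{}_{\mathfrak e}\times_{\mathfrak s}\mathcal A\to\mathcal A\,{}_{\mathfrak e}\times_{\mathfrak s}\mathcal A$ an isomorphism of quivers, written $\sigma(x,y)=(x\rightharpoonup y,x\leftharpoonup y)$, and $\mathbf q:\mathcal A\,{}_{\mathfrak e}\times_{\mathfrak s}\mathcal A\to\Bbbk^\times$ a function. Let $\sigma^{\mathbf q}:\Bbbk\mathcal A\otimes_{\Bbbk\mathcal P}\Bbbk\mathcal A\to\Bbbk\mathcal A\otimes_{\Bbbk\mathcal P}\Bbbk\mathcal A$ be the linear map $\sigma^{\mathbf q}(e_x\otimes e_y)=\mathbf q_{x,y}\,e_{x\rightharpoonup y}\otimes e_{x\leftharpoonup y}$ for $(x,y)\in\mathcal A\,{}_{\mathfrak e}\times_{\mathfrak s}\mathcal A$. Then $\sigma^{\mathbf q}$ is a solution of the braid equation in the category of $\Bbbk\mathcal P$-bimodules if and only if $(\mathcal A,\sigma)$ is a braided quiver and $$\mathbf q_{x,y}\,\mathbf q_{x\leftharpoonup y,\,z}\,\mathbf q_{x\rightharpoonup y,\,(x\leftharpoonup y)\rightharpoonup z}=\mathbf q_{y,z}\,\mathbf q_{x,\,y\rightharpoonup z}\,\mathbf q_{x\leftharpoonup(y\rightharpoonup z),\,y\leftharpoonup z}$$ for all $(x,y,z)\in\mathcal A\,{}_{\mathfrak e}\times_{\mathfrak s}\mathcal A\,{}_{\mathfrak e}\times_{\mathfrak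 s}\mathcal A$.
   Context: A quiver over $\mathcal P$ is a set $\mathcal A$ with maps $\mathfrak s,\mathfrak e:\mathcal A\to\mathcal P$; $\mathcal A\,{}_{\mathfrak e}\times_{\mathfrak s}\mathcal B=\{(a,b):\mathfrak e(a)=\mathfrak s(b)\}$ is a quiver with source $\mathfrak s(a)$ and end $\mathfrak e(b)$; isomorphisms of quivers preserve source and end. $(\mathcal A,\sigma)$ is a braided quiver if $(\sigma\times\mathrm{id})(\mathrm{id}\times\sigma)(\sigma\times\mathrm{id})=(\mathrm{id}\times\sigma)(\sigma\times\mathrm{id})(\mathrm{id}\times\sigma)$ on $\mathcal A\,{}_{\mathfrak e}\times_{\mathfrak s}\mathcal A\,{}_{\mathfrak e}\times_{\mathfrak s}\mathcal A$. The category of $\Bbbk\mathcal P$-bimodules is identified with the category of $\mathcal P\times\mathcal P$-graded vector spaces $M=\bigoplus_{P,Q}{}_PM_Q$ (degree $0$ maps), with tensor product ${}_P(M\otimes_{\Bbbk\mathcal P}N)_Q=\bigoplus_{R}{}_PM_R\otimes{}_RN_Q$. $\Bbbk\mathcal A$ has basis $(e_a)_{a\in\mathcal A}$, with $e_a$ of degree $(\mathfrak s(a),\mathfrak e(a))$; thus $\Bbbk\mathcal A\otimes_{\Bbbk\mathcal P}\Bbbk\mathcal A$ has basis $e_x\otimes e_y$ with $\mathfrak e(x)=\mathfrak s(y)$. A solution of the braid equation is an invertible $c:M\otimes M\to M\otimes M$ with $(c\otimes\mathrm{id})(\mathrm{id}\otimes c)(c\otimes\mathrm{id})=(\mathrm{id}\otimes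 c)(c\otimes\mathrm{id})(\mathrm{id}\otimes c)$. *)

(* Defs.v *)
From HB Require Import structures.
From mathcomp Require Import all_boot all_order all_algebra.
From mathcomp Require Import boolp.
From mathcomp.multinomials Require Export freeg.
Set Implicit Arguments.
Unset Strict Implicit.
Unset Printing Implicit Defensive.
Import GRing.Theory.
Local Open Scope ring_scope.
Local Open Scope quotient_scope.

Record quiver (P : Type) := Quiver {
  arrow :> Type;
  src : arrow -> P;
  tgt : arrow -> P }.

Record qhom (P : Type) (A B : quiver P) := QHom {
  qfun :> A -> B;
  src_qhom : forall a, src (qfun a) = src a;
  tgt_qhom : forall a, tgt (qfun a) = tgt a }.

Section Quivers.
Variable P : Type.
Implicit Types A B C : quiver P.

Definition qprod A B : quiver P :=
  @Quiver P {ab : A * B | tgt ab.1 = src ab.2}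
    (fun ab => src (sval ab).1) (fun ab => tgt (sval ab).2).

Definition qpair A B (a : A) (b : B) (h : tgt a = src b) : qprod A B :=
  exist _ (a, b) h.

Definition qid A : qhom A A := @QHom P A A id (fun=> erefl) (fun=> erefl).

Lemma qprod_map_subproof A A' B B' (f : qhom A A') (g : qhom B B')
    (ab : qprod A B) :
  tgt (f (sval ab).1) = src (g (sval ab).2).
Proof. by rewrite tgt_qhom src_qhom; exact: svalP ab. Qed.

Definition qprod_map A A' B B' (f : qhom A A') (g : qhom B B') :
    qhom (qprod A B) (qprod A' B') :=
  @QHom P (qprod A B) (qprod A' B')
    (fun ab => qpair (qprod_map_subproof f g ab))
    (fun ab => src_qhom f _) (fun ab => tgt_qhom g _).

Definition qprodA A B C : qhom (qprod (qprod A B) C) (qprod A (qprod B C)) :=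
  @QHom P (qprod (qprod A B) C) (qprod A (qprod B C))
    (fun t => let ab := (sval t).1 in
      @qpair A (qprod B C) (sval ab).1
        (@qpair B C (sval ab).2 (sval t).2 (svalP t)) (svalP ab))
    (fun=> erefl) (fun=> erefl).

Definition qprodAV A B C : qhom (qprod A (qprod B C)) (qprod (qprod A B) C) :=
  @QHom P (qprod A (qprod B C)) (qprod (qprod A B) C)
    (fun t => let bc := (sval t).2 in
      @qpair (qprod A B) C
        (@qpair A B (sval t).1 (sval bc).1 (svalP t)) (sval bc).2 (svalP bc))
    (fun=> erefl) (fun=> erefl).

Lemma qprod_eq A B (u v : qprod A B) : sval u = sval v -> u = v.
Proof. by case: u v => [u hu] [v hv] /= e; exact: eq_exist. Qed.

Lemma qprodAK A B C : cancel (qprodA A B C) (qprodAV A B C).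
Proof.
by move=> [[[[a b] hab] c] hc]; do 2!(apply: qprod_eq => //=; congr (_, _)).
Qed.

Lemma qprodAVK A B C : cancel (qprodAV A B C) (qprodA A B C).
Proof.
by move=> [[a [[b c] hbc]] ha]; do 2!(apply: qprod_eq => //=; congr (_, _)).
Qed.

Section Braiding.
Variables (A : quiver P) (sigma : qhom (qprod A A) (qprod A A)).

(* The triple product is taken as (A x A) x A, so [id x sigma] is conjugated
   by the reassociation. *)
Definition qbraid12 : qhom (qprod (qprod A A) A) (qprod (qprod A A) A) :=
  qprod_map sigma (qid A).

Definition qbraid23 (t : qprod (qprod A A) A) : qprod (qprod A A) A :=
  qprodAV A A A (qprod_map (qid A) sigma (qprodA A A A t)).

Definition braided_quiver : Prop :=
  forall t, qbraid12 (qbraid23 (qbraid12 t)) = qbraid23 (qbraid12 (qbraid23 t)).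

(* sigma (x, y) = (lact x y, ract x y); the composability proofs of the pairs
   are carried along explicitly. *)
Definition lact (x y : A) (h : tgt x = src y) : A := (sval (sigma (qpair h))).1.
Definition ract (x y : A) (h : tgt x = src y) : A := (sval (sigma (qpair h))).2.

Lemma src_lact x y (h : tgt x = src y) : src (lact h) = src x.
Proof. exact: (src_qhom sigma (qpair h)). Qed.

Lemma tgt_ract x y (h : tgt x = src y) : tgt (ract h) = tgt y.
Proof. exact: (tgt_qhom sigma (qpair h)). Qed.

Lemma tgt_lact x y (h : tgt x = src y) : tgt (lact h) = src (ract h).
Proof. exact: (svalP (sigma (qpair h))). Qed.

Section Triple.
Variables (x y z : A) (hxy : tgt x = src y) (hyz : tgt y = src z).

Lemma comp_ract_z : tgt (ract hxy) = src z.
Proof. by rewrite tgt_ract. Qed.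

Lemma comp_x_lact : tgt x = src (lact hyz).
Proof. by rewrite src_lact. Qed.

Lemma comp_lact_lact : tgt (lact hxy) = src (lact comp_ract_z).
Proof. by rewrite src_lact tgt_lact. Qed.

Lemma comp_ract_ract : tgt (ract comp_x_lact) = src (ract hyz).
Proof. by rewrite tgt_ract tgt_lact. Qed.
End Triple.

End Braiding.
End Quivers.

Section SpanQuotient.
Variables (K : fieldType) (V : lmodType K) (S : V -> Prop).

Definition spanned (w : V) : Prop :=
  forall U : V -> Prop, U 0 ->
    (forall (a : K) u v, U u -> U v -> U (a *: u + v)) ->
    (forall r, S r -> U r) -> U w.

Definition span_pred : {pred V} := fun w => `[< spanned w >].

Lemma span_predP w : reflect (spanned w) (w \in span_pred).
Proof. exact: asboolP. Qed.

Lemma span_closed : submod_closed span_pred.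
Proof.
split=> [|a u v /span_predP hu /span_predP hv]; apply/span_predP => U U0 UD US.
  exact: U0.
by apply: (UD); [exact: hu U0 UD US | exact: hv U0 UD US].
Qed.

HB.instance Definition _ :=
  GRing.isSubmodClosed.Build K V span_pred span_closed.

Definition span_quot : Type := Quotient.quot span_pred.
HB.instance Definition _ := GRing.Zmodule.on span_quot.

Definition span_pi (v : V) : span_quot := \pi_(Quotient.quot span_pred) v.
Definition span_repr (x : span_quot) : V :=
  repr (x : Quotient.quot span_pred).

Lemma span_reprK : cancel span_repr span_pi.
Proof. exact: reprK. Qed.

Lemma span_pi_eq u v : (span_pi u = span_pi v) <-> (u - v \in span_pred).
Proof.
rewrite Quotient.idealrBE; split=> [e|/eqP e]; last exact: e.
by apply/eqP; exact: e.
Qed.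

End SpanQuotient.

Section SpanQuotientLmodule.
Variables (K : fieldType) (V : lmodType K) (S : V -> Prop).
Local Notation Q := (span_quot S).
Local Notation pi := (span_pi S).

Definition span_scale (a : K) (x : Q) : Q := pi (a *: span_repr x).

Lemma span_piZ a v : pi (a *: v) = span_scale a (pi v).
Proof.
apply/span_pi_eq; rewrite -scalerBr rpredZ //.
by apply/span_pi_eq; rewrite span_reprK.
Qed.

Lemma span_piD : {morph pi : u v / u + v}.
Proof. move=> u v; exact: (raddfD (\pi_(Quotient.quot (span_pred S)))). Qed.

Lemma span_scaleA a b x : span_scale a (span_scale b x) = span_scale (a * b) x.
Proof. by rewrite -(span_reprK x) -!span_piZ scalerA. Qed.

Lemma span_scale1 : left_id 1 span_scale.
Proof. by move=> x; rewrite -(span_reprK x) -!span_piZ scale1r. Qed.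

Lemma span_scaleDr : right_distributive span_scale +%R.
Proof.
move=> a x y; rewrite -(span_reprK x) -(span_reprK y).
by rewrite -span_piD -!span_piZ scalerDr span_piD.
Qed.

Lemma span_scaleDl x : {morph span_scale^~ x : a b / a + b}.
Proof.
by move=> a b; rewrite -(span_reprK x) -!span_piZ scalerDl span_piD.
Qed.

HB.instance Definition _ := GRing.Zmodule_isLmodule.Build K Q
  span_scaleA span_scale1 span_scaleDr span_scaleDl.

Lemma span_pi_linear : linear pi.
Proof. by move=> a u v; rewrite span_piD span_piZ. Qed.

HB.instance Definition _ :=
  GRing.isLinear.Build K V Q *:%R pi span_pi_linear.

Section Lift.
Variables (W : lmodType K) (f : {linear V -> W}).
Hypothesis fS : forall r, S r -> f r = 0.

Lemma span_lift_repr v : f (span_repr (pi v)) = f v.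
Proof.
apply/eqP; rewrite -subr_eq0 -raddfB; apply/eqP.
have /span_pi_eq/span_predP/(_ (fun w => f w = 0)) : pi (span_repr (pi v)) = pi v.
  by rewrite span_reprK.
apply=> [|a u w fu fw|//]; first exact: raddf0.
by rewrite linearP fu fw scaler0 addr0.
Qed.

Lemma span_lift_linear : linear (f \o @span_repr K V S).
Proof.
move=> a x y /=; rewrite -linearP -[RHS]span_lift_repr.
by rewrite span_pi_linear !span_reprK.
Qed.
End Lift.

End SpanQuotientLmodule.

Lemma freegU_scale (K : fieldType) (T : choiceType) (c : K) (x : T) :
  << c *g x >> = c *: << x >> :> {freeg T / K}.
Proof. by apply/eqP/freeg_eqP => y; rewrite coeffZ !coeffU mul1r. Qed.

Section FreeLift.
Variables (K : fieldType) (T : choiceType) (W : lmodType K) (f : T -> W).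

Lemma fglift_linear : linear (fglift f : {freeg T / K} -> W).
Proof.
have addf : zmod_morphism (fglift f : {freeg T / K} -> W).
  exact: (lift_is_additive f).
pose F := GRing.isZmodMorphism.Build _ _ _ addf.
pose g : {additive {freeg T / K} -> W} := HB.pack (fglift f) F.
have gZ a u : g (a *: u) = a *: g u.
  rewrite -[u in RHS]freeg_sumE (_ : a *: u = fgscale a u) // /fgscale.
  by rewrite !raddf_sum; apply: eq_bigr => x _; rewrite /= !liftU scalerA.
by move=> a u v; rewrite -[LHS]/(g (a *: u + v)) raddfD gZ.
Qed.

Definition free_lift : {freeg T / K} -> W := fglift f.
HB.instance Definition _ :=
  GRing.isLinear.Build K {freeg T / K} W *:%R free_lift fglift_linear.

Lemma free_liftU x : free_lift << x >> = f x.
Proof. by rewrite /free_lift liftU scale1r. Qed.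
End FreeLift.

(* M p q is the homogeneous component of degree (p, q); morphisms have
   degree 0. *)
Definition gvect (K : fieldType) (P : Type) := P -> P -> lmodType K.

Definition ghom (K : fieldType) (P : Type) (M N : gvect K P) :=
  forall p q, {linear M p q -> N p q}.

Definition ghom_id (K : fieldType) (P : Type) (M : gvect K P) : ghom M M :=
  fun p q => idfun.

Section Tensor.
Variables (K : fieldType) (P : Type) (M N : gvect K P).

(* The direct sum over r of M p r (x) N r q is the quotient of the vector space
   freely generated by the triples (r, m, n) by the bilinearity relations for
   each r. *)
Definition tgen (p q : P) : Type := {r : P & (M p r * N r q)%type}.
Definition tfree (p q : P) : lmodType K := {freeg {classic tgen p q} / K}.

Definition tfree_gen p r q (m : M p r) (n : N r q) : tfree p q :=
  << (existT _ r (m, n) : {classic tgen p q}) >>.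

Inductive tensor_rel p q : tfree p q -> Prop :=
| Tensor_linear_l r a (m m' : M p r) (n : N r q) : tensor_rel
    (tfree_gen (a *: m + m') n - (a *: tfree_gen m n + tfree_gen m' n))
| Tensor_linear_r r a (m : M p r) (n n' : N r q) : tensor_rel
    (tfree_gen m (a *: n + n') - (a *: tfree_gen m n + tfree_gen m n')).

Definition tensor : gvect K P := fun p q => span_quot (@tensor_rel p q).

Definition pure p r q (m : M p r) (n : N r q) : tensor p q :=
  span_pi (@tensor_rel p q) (tfree_gen m n).

Lemma pure_linear_l p r q (n : N r q) : linear (fun m : M p r => pure m n).
Proof.
move=> a m m'; rewrite -linearP; apply/span_pi_eq/span_predP => U _ _ US.
by apply: US; constructor.
Qed.

Lemma pure_linear_r p r q (m : M p r) : linear (fun n : N r q => pure m n).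
Proof.
move=> a n n'; rewrite -linearP; apply/span_pi_eq/span_predP => U _ _ US.
by apply: US; constructor.
Qed.

Section Lift.
Variables (p q : P) (W : lmodType K) (b : forall r, M p r -> N r q -> W).
Hypothesis b_linear_l : forall r n, linear (fun m => @b r m n).
Hypothesis b_linear_r : forall r m, linear (@b r m).

Definition tfree_lift : {linear tfree p q -> W} :=
  free_lift (fun t : {classic tgen p q} => b (tagged t).1 (tagged t).2).

Lemma tfree_lift_rel t : tensor_rel t -> tfree_lift t = 0.
Proof.
by case=> r a m m' n; rewrite linearB linearP /= !free_liftU /=;
  rewrite (b_linear_l, b_linear_r) subrr.
Qed.

Definition tensor_lift_fun : tensor p q -> W :=
  tfree_lift \o @span_repr _ _ (@tensor_rel p q).

HB.instance Definition _ := GRing.isLinear.Build K (tensor p q) W *:%R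
  tensor_lift_fun (span_lift_linear tfree_lift_rel).

Definition tensor_lift : {linear tensor p q -> W} := tensor_lift_fun.

Lemma tensor_lift_pure r (m : M p r) (n : N r q) :
  tensor_lift (pure m n) = b m n.
Proof.
rewrite /= /tensor_lift_fun /= /pure (span_lift_repr tfree_lift_rel).
exact: free_liftU.
Qed.

End Lift.

Lemma tensor_ext p q (W : lmodType K) (f g : {linear tensor p q -> W}) :
  (forall r (m : M p r) (n : N r q), f (pure m n) = g (pure m n)) -> f =1 g.
Proof.
move=> fg x; rewrite -(span_reprK x) -[span_repr x]freeg_sumE !raddf_sum /=.
apply: eq_bigr => -[r [m n]] _; rewrite freegU_scale !linearZ /=.
by congr (_ *: _); exact: fg.
Qed.

End Tensor.

Section TensorMap.
Variables (K : fieldType) (P : Type) (M M' N N' : gvect K P).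
Variables (f : ghom M M') (g : ghom N N').

Let b p q r (m : M p r) (n : N r q) : tensor M' N' p q :=
  pure (f p r m) (g r q n).

Lemma tensor_map_linear_l p q r (n : N r q) :
  linear (fun m : M p r => b m n).
Proof. by move=> a m m'; rewrite /b linearP pure_linear_l. Qed.

Lemma tensor_map_linear_r p q r (m : M p r) :
  linear (fun n : N r q => b m n).
Proof. by move=> a n n'; rewrite /b linearP pure_linear_r. Qed.

Definition tensor_map : ghom (tensor M N) (tensor M' N') := fun p q =>
  tensor_lift (@tensor_map_linear_l p q) (@tensor_map_linear_r p q).

Lemma tensor_map_pure p r q (m : M p r) (n : N r q) :
  tensor_map p q (pure m n) = pure (f p r m) (g r q n).
Proof. exact: tensor_lift_pure. Qed.
End TensorMap.

Section TensorAssoc.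
Variables (K : fieldType) (P : Type) (M N L : gvect K P).

Section Left.
Variables (p q : P).

Let b r (l : L r q) s (m : M p s) (n : N s r) : tensor M (tensor N L) p q :=
  pure m (pure n l).

Lemma tensorA_with_linear_m r (l : L r q) s (n : N s r) :
  linear (fun m : M p s => b l m n).
Proof. exact: pure_linear_l. Qed.

Lemma tensorA_with_linear_n r (l : L r q) s (m : M p s) :
  linear (fun n : N s r => b l m n).
Proof. by move=> a n n'; rewrite /b pure_linear_l pure_linear_r. Qed.

Definition tensorA_with r (l : L r q) :
    {linear tensor M N p r -> tensor M (tensor N L) p q} :=
  tensor_lift (tensorA_with_linear_m l) (tensorA_with_linear_n l).

Lemma tensorA_with_pure r (l : L r q) s (m : M p s) (n : N s r) :
  tensorA_with l (pure m n) = pure m (pure n l).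
Proof. exact: tensor_lift_pure. Qed.

Arguments tensorA_with : simpl never.

Lemma tensorA_with_linear_r r (t : tensor M N p r) :
  linear (fun l : L r q => tensorA_with l t).
Proof.
move=> a l l'; move: t.
apply: (tensor_ext (g := a \*: tensorA_with l \+ tensorA_with l')) => s m n.
 rewrite /= !tensorA_with_pure.
exact: etrans (congr1 _ (pure_linear_r n a l l')) (pure_linear_r m a _ _).
Qed.
End Left.

Definition tensorA : ghom (tensor (tensor M N) L) (tensor M (tensor N L)) :=
  fun p q => @tensor_lift K P (tensor M N) L p q _
    (fun r t l => @tensorA_with p q r l t)
    (fun r l => linearP (@tensorA_with p q r l))
    (@tensorA_with_linear_r p q).

Lemma tensorA_pure p r s q (m : M p r) (n : N r s) (l : L s q) :
  tensorA p q (pure (pure m n) l) = pure m (pure n l).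
Proof. by rewrite /tensorA tensor_lift_pure tensorA_with_pure. Qed.
Section Right.
Variables (p q : P).
Let b r (m : M p r) s (n : N r s) (l : L s q) : tensor (tensor M N) L p q :=
  pure (pure m n) l.

Lemma tensorAV_with_linear_n r (m : M p r) s (l : L s q) :
  linear (fun n : N r s => b m n l).
Proof. by move=> a n n'; rewrite /b pure_linear_r pure_linear_l. Qed.

Lemma tensorAV_with_linear_l r (m : M p r) s (n : N r s) :
  linear (fun l : L s q => b m n l).
Proof. exact: pure_linear_r. Qed.

Definition tensorAV_with r (m : M p r) :
    {linear tensor N L r q -> tensor (tensor M N) L p q} :=
  tensor_lift (tensorAV_with_linear_n m) (tensorAV_with_linear_l m).

Lemma tensorAV_with_pure r (m : M p r) s (n : N r s) (l : L s q) :
  tensorAV_with m (pure n l) = pure (pure m n) l.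
Proof. exact: tensor_lift_pure. Qed.

Arguments tensorAV_with : simpl never.

Lemma tensorAV_with_linear_m r (t : tensor N L r q) :
  linear (fun m : M p r => tensorAV_with m t).
Proof.
move=> a m m'; move: t.
apply: (tensor_ext (g := a \*: tensorAV_with m \+ tensorAV_with m')) => s n l.
rewrite /= !tensorAV_with_pure.
exact: etrans (congr1 (fun x => pure x l) (pure_linear_l n a m m'))
  (pure_linear_l l a _ _).
Qed.
End Right.

Definition tensorAV : ghom (tensor M (tensor N L)) (tensor (tensor M N) L) :=
  fun p q => @tensor_lift K P M (tensor N L) p q _
    (fun r m t => @tensorAV_with p q r m t)
    (@tensorAV_with_linear_m p q)
    (fun r m => linearP (@tensorAV_with p q r m)).

Lemma tensorAV_pure p r s q (m : M p r) (n : N r s) (l : L s q) :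
  tensorAV p q (pure m (pure n l)) = pure (pure m n) l.
Proof. by rewrite /tensorAV tensor_lift_pure tensorAV_with_pure. Qed.

Lemma tensorAK p q : cancel (tensorA p q) (tensorAV p q).
Proof.
apply: (tensor_ext (f := tensorAV p q \o tensorA p q) (g := idfun)) => s t l.
have E (l' : L s q) : linear (fun t : tensor M N p s => pure t l').
  exact: pure_linear_l.
pose T : {linear tensor M N p s -> tensor (tensor M N) L p q} :=
  HB.pack (fun t : tensor M N p s => pure t l)
    (GRing.isLinear.Build K _ _ *:%R (fun t : tensor M N p s => pure t l) (E l)).
move: t; apply: (tensor_ext (f := tensorAV p q \o tensorA p q \o T) (g := T)).
by move=> r m n; rewrite /= tensorA_pure tensorAV_pure.
Qed.

Lemma tensorAVK p q : cancel (tensorAV p q) (tensorA p q).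
Proof.
apply: (tensor_ext (f := tensorA p q \o tensorAV p q) (g := idfun)) => r m t.
pose T : {linear tensor N L r q -> tensor M (tensor N L) p q} :=
  HB.pack (fun t : tensor N L r q => pure m t)
    (GRing.isLinear.Build K _ _ *:%R (fun t : tensor N L r q => pure m t)
      (pure_linear_r m)).
move: t; apply: (tensor_ext (f := tensorA p q \o tensorAV p q \o T) (g := T)).
by move=> s n l; rewrite /= tensorAV_pure tensorA_pure.
Qed.
End TensorAssoc.

Section BraidEquation.
Variables (K : fieldType) (P : Type) (M : gvect K P).
Variable c : ghom (tensor M M) (tensor M M).

Definition ghom_invertible : Prop :=
  exists d : ghom (tensor M M) (tensor M M),
    forall p q, cancel (c p q) (d p q) /\ cancel (d p q) (c p q).

(* As for quivers, the triple tensor product is taken as (M (x) M) (x) M. *)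
Definition braid12 : ghom (tensor (tensor M M) M) (tensor (tensor M M) M) :=
  tensor_map c (ghom_id M).

Definition braid23 : ghom (tensor (tensor M M) M) (tensor (tensor M M) M) :=
  fun p q =>
    tensorAV M M M p q \o tensor_map (ghom_id M) c p q \o tensorA M M M p q.

Definition braid_solution : Prop :=
  ghom_invertible /\
  forall p q t,
    braid12 p q (braid23 p q (braid12 p q t)) =
    braid23 p q (braid12 p q (braid23 p q t)).
End BraidEquation.

Section Linearization.
Variables (K : fieldType) (P : Type).
Implicit Types A B : quiver P.

Definition qarrows A (p q : P) : Type := {a : A | src a = p /\ tgt a = q}.

Definition qarrows_map A B (f : qhom A B) p q (a : qarrows A p q) :
    qarrows B p q :=
  exist _ (f (sval a))
    (conj (etrans (src_qhom f _) (svalP a).1)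
          (etrans (tgt_qhom f _) (svalP a).2)).

Definition qarrows_pair A B p r q (a : qarrows A p r) (b : qarrows B r q) :
    qarrows (qprod A B) p q :=
  exist _ (@qpair P A B (sval a) (sval b)
            (etrans (svalP a).2 (esym (svalP b).1)))
    (conj (svalP a).1 (svalP b).2).

(* The component of degree (p, q) is free on the arrows from p to q. *)
Definition kquiver A : gvect K P :=
  fun p q => {freeg {classic qarrows A p q} / K}.

Definition kbasis A p q (a : qarrows A p q) : kquiver A p q :=
  << (a : {classic qarrows A p q}) >>.

(* e_x (x) e_y for z = (x, y). *)
Definition kbasis2 A B p q (z : qarrows (qprod A B) p q) :
    tensor (kquiver A) (kquiver B) p q :=
  @pure K P (kquiver A) (kquiver B) p (tgt (sval (sval z)).1) q
    (kbasis (exist _ (sval (sval z)).1 (conj (svalP z).1 erefl)))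
    (kbasis (exist _ (sval (sval z)).2
               (conj (esym (svalP (sval z))) (svalP z).2))).

Lemma kbasis2_pair A B p r q (a : qarrows A p r) (b : qarrows B r q) :
  kbasis2 (qarrows_pair a b) = pure (kbasis a) (kbasis b).
Proof.
case: a b => a [ha ?] [b [hb ?]]; subst r; rewrite /kbasis2 /=.
by congr (pure (kbasis _) (kbasis _)); exact: eq_exist.
Qed.

Lemma kquiver_ext A p q (W : lmodType K) (f g : {linear kquiver A p q -> W}) :
  (forall a, f (kbasis a) = g (kbasis a)) -> f =1 g.
Proof.
move=> fg x; rewrite -[x]freeg_sumE !raddf_sum.
apply: eq_bigr => a _; set c := coeff a x.
have -> : << c *g a >> = c *: kbasis a :> kquiver A p q by exact: freegU_scale.
by rewrite /= !linearZ /= fg.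
Qed.

Section Twist.
Variables (A : quiver P) (sigma : qhom (qprod A A) (qprod A A)).
Variable qq : qprod A A -> K.

(* The value of sigma^qq on e_x (x) e_y, for z = (x, y); [twist] below is its
   linear extension, see [twistE] and [twist_unique]. *)
Definition twist_basis p q (z : qarrows (qprod A A) p q) :
    tensor (kquiver A) (kquiver A) p q :=
  qq (sval z) *: kbasis2 (qarrows_map sigma z).

Section Bilinear.
Variables (p q r : P).

Definition twist_with (a : qarrows A p r) :
    {linear kquiver A r q -> tensor (kquiver A) (kquiver A) p q} :=
  free_lift (fun b : {classic qarrows A r q} => twist_basis (qarrows_pair a b)).

Definition twist_bil (u : kquiver A p r) (v : kquiver A r q) :
    tensor (kquiver A) (kquiver A) p q :=
  free_lift (fun a : {classic qarrows A p r} => twist_with a v) u.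

Lemma twist_linear_l v : linear (twist_bil^~ v).
Proof. exact: linearP. Qed.

Lemma twist_bil_basis a v : twist_bil (kbasis a) v = twist_with a v.
Proof. exact: free_liftU. Qed.

Lemma twist_with_basis a b :
  twist_with a (kbasis b) = twist_basis (qarrows_pair a b).
Proof. exact: free_liftU. Qed.

Lemma twist_linear_r u : linear (twist_bil u).
Proof.
move=> c v v'; pose F w : {linear kquiver A p r -> _} :=
  free_lift (fun a : {classic qarrows A p r} => twist_with a w).
move: u; apply: (kquiver_ext (f := F _) (g := c \*: F v \+ F v')) => a.
rewrite -[LHS]/(twist_bil _ _) twist_bil_basis linearP.
by rewrite -!twist_bil_basis.
Qed.
End Bilinear.

Definition twist : ghom (tensor (kquiver A) (kquiver A))
                        (tensor (kquiver A) (kquiver A)) :=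
  fun p q => tensor_lift (fun r => @twist_linear_l p q r)
                         (fun r => @twist_linear_r p q r).

Lemma twistE p q (z : qarrows (qprod A A) p q) :
  twist p q (kbasis2 z) = qq (sval z) *: kbasis2 (qarrows_map sigma z).
Proof.
rewrite /twist /kbasis2 tensor_lift_pure twist_bil_basis twist_with_basis.
rewrite -/(twist_basis z); congr twist_basis.
by case: z => [[[x y] h] [hx hy]]; apply: eq_exist; exact: eq_exist.
Qed.

Lemma twist_unique (f : ghom (tensor (kquiver A) (kquiver A))
                             (tensor (kquiver A) (kquiver A))) :
  (forall p q (z : qarrows (qprod A A) p q),
     f p q (kbasis2 z) = qq (sval z) *: kbasis2 (qarrows_map sigma z)) ->
  forall p q, f p q =1 twist p q.
Proof.
move=> fE p q; apply: tensor_ext => r u v.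
pose R (u : kquiver A p r) : {linear kquiver A r q -> _} :=
  HB.pack (fun v : kquiver A r q => pure u v)
    (GRing.isLinear.Build K _ _ *:%R _ (pure_linear_r u)).
pose L (v : kquiver A r q) : {linear kquiver A p r -> _} :=
  HB.pack (fun u : kquiver A p r => pure u v)
    (GRing.isLinear.Build K _ _ *:%R _ (pure_linear_l v)).
move: u; apply: (kquiver_ext (f := f p q \o L v) (g := twist p q \o L v)) => a.
rewrite -[LHS]/((f p q \o R (kbasis a)) v) -[RHS]/((twist p q \o R (kbasis a)) v).
move: v; apply: kquiver_ext => b /=.
by rewrite -kbasis2_pair fE twistE.
Qed.
End Twist.
End Linearization.

(* Main.v *)
(** The tensors e_x (x) e_y (x) e_z, indexed by the composable triples (x, y, z),
    form a basis of the triple tensor product, and both sides of the braid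
    equation are monomial in it: each one sends a basis vector to a non-zero
    scalar times a basis vector.  The underlying vectors agree for all triples
    exactly when sigma is a braiding, and the scalars agree exactly when the
    identity on q holds. *)
From HB Require Import structures.
Require Import Defs.
From mathcomp Require Import all_boot all_algebra.
From mathcomp Require Import boolp.
Import GRing.Theory.
Local Open Scope ring_scope.
Set Implicit Arguments.
Unset Strict Implicit.
Unset Printing Implicit Defensive.

(** * Preliminaries on pure tensors and homogeneous arrows *)

Section PureLinear.
Variables (K : fieldType) (P : Type) (M N : gvect K P) (p r q : P).

Definition pure_l (n : N r q) : {linear M p r -> tensor M N p q} :=
  HB.pack (fun m : M p r => pure m n)
    (GRing.isLinear.Build K _ _ *:%R _ (pure_linear_l n)).

Definition pure_r (m : M p r) : {linear N r q -> tensor M N p q} :=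
  HB.pack (fun n : N r q => pure m n)
    (GRing.isLinear.Build K _ _ *:%R _ (pure_linear_r m)).

Lemma pureZl a (m : M p r) (n : N r q) : pure (a *: m) n = a *: pure m n.
Proof. exact: (linearZ_LR (pure_l n)). Qed.

Lemma pureZr a (m : M p r) (n : N r q) : pure m (a *: n) = a *: pure m n.
Proof. exact: (linearZ_LR (pure_r m)). Qed.

End PureLinear.

Arguments pure_l {K P} M N {p r q} n.
Arguments pure_r {K P} M N {p r q} m.

Lemma qarrows_eq (P : Type) (A : quiver P) (p q : P)
    (u v : qarrows A p q) :
  sval u = sval v -> u = v.
Proof. by case: u v => [u hu] [v hv] /= e; exact: eq_exist. Qed.

(** The middle vertex is the end of the first arrow. Making it a variable [r] lets the lemmas on
    [qarrows_pair] and on pure tensors rewrite an arbitrary composable pair. *)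
Lemma qarrows_pairP (P : Type) (A B : quiver P) (p q : P)
    (z : qarrows (qprod A B) p q) :
  exists r (a : qarrows A p r) (b : qarrows B r q), z = qarrows_pair a b.
Proof.
case: z => [[[a b] h] [ha hb]].
exists (tgt a), (exist _ a (conj ha erefl)), (exist _ b (conj (esym h) hb)).
by apply: qarrows_eq; apply: qprod_eq.
Qed.

(** Compare the coefficients at [a]: on the left [c]; on the right [c'] if [a' = a] and 0 otherwise,
    which [c != 0] excludes. *)
Lemma kbasis_monomial_inj (K : fieldType) (P : Type) (A : quiver P) (p q : P)
    (c c' : K) (a a' : qarrows A p q) :
  c != 0 -> c *: kbasis K a = c' *: kbasis K a' -> a = a' /\ c = c'.
Proof.
move=> c0 /(congr1 (@coeff K {classic qarrows A p q} a)).
rewrite /kbasis !coeffZ !coeffU !mul1r eqxx mulr1.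
case: eqP => [<- ->|_ e0]; first by rewrite mulr1.
by rewrite e0 mulr0 eqxx in c0.
Qed.

(** * Basis of the tensor product of two linearized quivers *)

Section TensorBasis.
Variables (K : fieldType) (P : Type) (A B : quiver P).
Local Notation kA := (kquiver K A).
Local Notation kB := (kquiver K B).

(** This is the spanning half: a pure tensor is linear in each factor, so the factors are reduced to
    basis vectors one at a time. *)
Lemma kbasis2_ext p q (W : lmodType K)
    (f g : {linear tensor (kquiver K A) (kquiver K B) p q -> W}) :
  (forall z, f (kbasis2 K z) = g (kbasis2 K z)) -> f =1 g.
Proof.
move=> fg; apply: tensor_ext => r u v.
move: u; apply: (kquiver_ext (f := f \o pure_l kA kB v)
                             (g := g \o pure_l kA kB v)) => a.
move: v; apply: (kquiver_ext (f := f \o pure_r kA kB (kbasis K a))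
                             (g := g \o pure_r kA kB (kbasis K a))) => b /=.
by rewrite -kbasis2_pair fg.
Qed.

Section Bilinear.
Variables (p q r : P).

Definition kpair_with (a : qarrows A p r) :
    {linear kquiver K B r q -> kquiver K (qprod A B) p q} :=
  free_lift (fun b : {classic qarrows B r q} => kbasis K (qarrows_pair a b)).

Definition kpair_bil (u : kA p r) (v : kB r q) : kquiver K (qprod A B) p q :=
  free_lift (fun a : {classic qarrows A p r} => kpair_with a v) u.

Lemma kpair_linear_l v : linear (kpair_bil^~ v).
Proof. exact: linearP. Qed.

Lemma kpair_bil_basis a v : kpair_bil (kbasis K a) v = kpair_with a v.
Proof. exact: free_liftU. Qed.

Lemma kpair_with_basis a b :
  kpair_with a (kbasis K b) = kbasis K (qarrows_pair a b).
Proof. exact: free_liftU. Qed.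

(** Both sides of the linearity identity are linear in [u], hence it is enough to compare them on
    basis vectors [a], where [kpair_with a] is linear. *)
Lemma kpair_linear_r u : linear (kpair_bil u).
Proof.
move=> c v v'; pose F w : {linear kA p r -> _} :=
  free_lift (fun a : {classic qarrows A p r} => kpair_with a w).
move: u; apply: (kquiver_ext (f := F _) (g := c \*: F v \+ F v')) => a.
rewrite -[LHS]/(kpair_bil _ _) kpair_bil_basis linearP.
by rewrite -!kpair_bil_basis.
Qed.

End Bilinear.

(* The coordinate map showing that the e_x (x) e_y are linearly independent. *)
Definition kpair : ghom (tensor kA kB) (kquiver K (qprod A B)) :=
  fun p q => tensor_lift (fun r => @kpair_linear_l p q r)
                         (fun r => @kpair_linear_r p q r).

Lemma kpair_pure p q r (a : qarrows A p r) (b : qarrows B r q) :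
  kpair p q (pure (kbasis K a) (kbasis K b)) = kbasis K (qarrows_pair a b).
Proof.
by rewrite /kpair tensor_lift_pure kpair_bil_basis kpair_with_basis.
Qed.

Lemma kpair_basis2 p q (z : qarrows (qprod A B) p q) :
  kpair p q (kbasis2 K z) = kbasis K z.
Proof.
by have [r [a [b ->]]] := qarrows_pairP z; rewrite kbasis2_pair kpair_pure.
Qed.

End TensorBasis.

(** * Basis of the triple tensor product *)

Section TripleBasis.
Variables (K : fieldType) (P : Type) (A : quiver P).
Local Notation A3 := (qprod (qprod A A) A).
Local Notation kA := (kquiver K A).
Local Notation T3 := (tensor (tensor kA kA) kA).

Definition kbasis3 p q (z : qarrows A3 p q) : T3 p q :=
  @pure K P (tensor kA kA) kA p (tgt (sval (sval z)).1) q
    (kbasis2 K (exist _ (sval (sval z)).1 (conj (svalP z).1 erefl)))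
    (kbasis K (exist _ (sval (sval z)).2
               (conj (esym (svalP (sval z))) (svalP z).2))).

Lemma kbasis3_pair p r q (w : qarrows (qprod A A) p r) (c : qarrows A r q) :
  kbasis3 (qarrows_pair w c) =
  @pure K P (tensor kA kA) kA p r q (kbasis2 K w) (kbasis K c).
Proof.
case: w c => w [hw hr] [c [hc ?]]; subst r; rewrite /kbasis3 /=.
by congr (pure (kbasis2 K _) (kbasis K _)); exact: eq_exist.
Qed.

Lemma kbasis3_ext p q (W : lmodType K) (f g : {linear T3 p q -> W}) :
  (forall z, f (kbasis3 z) = g (kbasis3 z)) -> f =1 g.
Proof.
move=> fg; apply: tensor_ext => r u v.
move: u; apply: (kbasis2_ext (f := f \o pure_l (tensor kA kA) kA v)
                             (g := g \o pure_l (tensor kA kA) kA v)) => w.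
move: v; apply: (kquiver_ext (f := f \o pure_r (tensor kA kA) kA (kbasis2 K w))
                             (g := g \o pure_r (tensor kA kA) kA (kbasis2 K w))) =>
  c /=.
by rewrite -kbasis3_pair fg.
Qed.

(** This is the independence half: [D] applies [kpair] to the first two factors and then to the
    result, which carries [kbasis3 t] to the basis vector of [t] in a free space. *)
Lemma kbasis3_monomial_inj p q (c c' : K) (z z' : qarrows A3 p q) :
  c != 0 -> c *: kbasis3 z = c' *: kbasis3 z' -> z = z' /\ c = c'.
Proof.
pose D : T3 p q -> kquiver K A3 p q :=
  kpair K _ _ p q \o tensor_map (@kpair K P A A) (ghom_id kA) p q.
have DZ a t : D (a *: kbasis3 t) = a *: D (kbasis3 t).
  by rewrite /D /comp !linearZ_LR.
suff E t : D (kbasis3 t) = kbasis K t.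
  by move=> c0 /(congr1 D); rewrite !DZ !E; exact: kbasis_monomial_inj.
rewrite /D /comp.
have [r [w [b ->]]] := qarrows_pairP t.
by rewrite kbasis3_pair tensor_map_pure kpair_basis2 kpair_pure.
Qed.

End TripleBasis.

(** * The two sides of the braid equation on basis triples *)

Section BraidLinear.
Variables (K : fieldType) (P : Type) (M : gvect K P).
Variable c : ghom (tensor M M) (tensor M M).

Lemma braid12Z p q a t : braid12 c p q (a *: t) = a *: braid12 c p q t.
Proof. exact: linearZ_LR. Qed.

Lemma braid23Z p q a t : braid23 c p q (a *: t) = a *: braid23 c p q t.
Proof. exact: linearZ_LR. Qed.

End BraidLinear.

Section Braid.
Variables (K : fieldType) (P : Type) (A : quiver P).
Variables (sigma : qhom (qprod A A) (qprod A A)) (q : qprod A A -> K).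
Local Notation A3 := (qprod (qprod A A) A).

Definition fst_pair (t : A3) : qprod A A := (sval t).1.
Definition snd_pair (t : A3) : qprod A A := (sval (qprodA A A A t)).2.

(** [qbraid23] is a bare function on triples; bundled with its compatibility with source and end, it
    acts on the arrows of each degree. *)
Definition qbraid23_hom : qhom A3 A3 :=
  @QHom P A3 A3 (qbraid23 sigma) (fun=> erefl)
    (fun t => tgt_qhom sigma (snd_pair t)).

Lemma braid12_basis p r (z : qarrows A3 p r) :
  braid12 (twist sigma q) p r (kbasis3 K z) =
  q (fst_pair (sval z)) *: kbasis3 K (qarrows_map (qbraid12 sigma) z).
Proof.
have [s [w [c ->]]] := qarrows_pairP z.
rewrite kbasis3_pair /braid12 tensor_map_pure twistE pureZl -kbasis3_pair.
by congr (_ *: kbasis3 K _); apply: qarrows_eq; apply: qprod_eq.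
Qed.

Lemma braid23_basis p r (z : qarrows A3 p r) :
  braid23 (twist sigma q) p r (kbasis3 K z) =
  q (snd_pair (sval z)) *: kbasis3 K (qarrows_map qbraid23_hom z).
Proof.
have [s [w [c ->]]] := qarrows_pairP z.
(* The associator is computed only on pure tensors of three factors, so the first pair is split as
   well. *)
have [s' [a [b ->]]] := qarrows_pairP w.
rewrite kbasis3_pair kbasis2_pair /braid23.
rewrite -[LHS]/(tensorAV _ _ _ _ _ (tensor_map _ _ _ _ (tensorA _ _ _ _ _ _))).
rewrite tensorA_pure tensor_map_pure.
rewrite -kbasis2_pair twistE.
(* The image under [sigma] has its own middle vertex [s'']; splitting it makes [tensorAV]
   computable. *)
have [s'' [b' [c' e]]] := qarrows_pairP (qarrows_map sigma (qarrows_pair b c)).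
rewrite e kbasis2_pair pureZr linearZ_LR tensorAV_pure -kbasis2_pair.
rewrite -kbasis3_pair; congr (q _ *: kbasis3 K _); first exact: qprod_eq.
apply: qarrows_eq; apply: qprod_eq => /=.
(* [w'] is [sigma] at the pair [(b, c)] with another composability proof, hence its underlying
   arrows are those of [b'] and [c']. *)
set w' := sigma _.
have {e} ew : w' = sval (qarrows_pair b' c').
  by rewrite -e /w' /=; congr (sigma _); exact: qprod_eq.
congr (_, _); last by rewrite ew.
apply: qprod_eq; congr (_, _).
by rewrite -[LHS]/(sval (sval (qarrows_pair b' c'))).1 -ew.
Qed.

(** The digit 1 stands for braiding the first two factors, 2 for the last two; this is the scalar
    picked up along 1, 2, 1. *)
Definition weight121 (t : A3) : K :=
  q (fst_pair t) * q (snd_pair (qbraid12 sigma t)) *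
  q (fst_pair (qbraid23 sigma (qbraid12 sigma t))).

Definition weight212 (t : A3) : K :=
  q (snd_pair t) * q (fst_pair (qbraid23 sigma t)) *
  q (snd_pair (qbraid12 sigma (qbraid23 sigma t))).

Definition qmap121 p r (z : qarrows A3 p r) : qarrows A3 p r :=
  qarrows_map (qbraid12 sigma)
    (qarrows_map qbraid23_hom (qarrows_map (qbraid12 sigma) z)).

Definition qmap212 p r (z : qarrows A3 p r) : qarrows A3 p r :=
  qarrows_map qbraid23_hom
    (qarrows_map (qbraid12 sigma) (qarrows_map qbraid23_hom z)).

Lemma braid121_basis p r (z : qarrows A3 p r) :
  braid12 (twist sigma q) p r (braid23 (twist sigma q) p r
    (braid12 (twist sigma q) p r (kbasis3 K z))) =
  weight121 (sval z) *: kbasis3 K (qmap121 z).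
Proof.
by rewrite braid12_basis braid23Z braid23_basis !braid12Z braid12_basis
  !scalerA.
Qed.

Lemma braid212_basis p r (z : qarrows A3 p r) :
  braid23 (twist sigma q) p r (braid12 (twist sigma q) p r
    (braid23 (twist sigma q) p r (kbasis3 K z))) =
  weight212 (sval z) *: kbasis3 K (qmap212 z).
Proof.
by rewrite braid23_basis braid12Z braid12_basis !braid23Z braid23_basis
  !scalerA.
Qed.

Lemma twist_invertible :
  bijective sigma -> (forall xy, q xy != 0) -> ghom_invertible (twist sigma q).
Proof.
move=> [tau sK tK] q0.
have stau a : src (tau a) = src a by rewrite -[in RHS](tK a) src_qhom.
have ttau a : tgt (tau a) = tgt a by rewrite -[in RHS](tK a) tgt_qhom.
pose tauh := QHom stau ttau.
(* [twist sigma q] sends the basis vector of [tau z] to [q (tau z)] times that of [z], so its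
   inverse divides by this scalar. *)
exists (twist tauh (fun z => (q (tau z))^-1)) => p r; split.
  apply: (kbasis2_ext (f := twist tauh _ p r \o twist sigma q p r)
                      (g := idfun)) => z.
  rewrite -[LHS]/(twist tauh _ _ _ (twist sigma q _ _ _)).
  rewrite twistE linearZ_LR twistE scalerA /= sK mulfV // scale1r.
  by congr kbasis2; apply: qarrows_eq; rewrite /= sK.
apply: (kbasis2_ext (f := twist sigma q p r \o twist tauh _ p r)
                    (g := idfun)) => z.
rewrite -[LHS]/(twist sigma q _ _ (twist tauh _ _ _ _)).
rewrite twistE linearZ_LR twistE scalerA /= mulVf // scale1r.
by congr kbasis2; apply: qarrows_eq; rewrite /= tK.
Qed.

(** The pairs on both sides consist of the same arrows and differ only in composability proofs,
    which [qprod_eq] disregards. *)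
Lemma weight121E (x y z : A) (hxy : tgt x = src y) (hyz : tgt y = src z) :
  weight121 (@qpair P (qprod A A) A (qpair hxy) z hyz) =
  q (qpair hxy) * q (qpair (comp_ract_z sigma hxy hyz)) *
  q (qpair (comp_lact_lact sigma hxy hyz)).
Proof.
have e2 : snd_pair (qbraid12 sigma (@qpair P (qprod A A) A (qpair hxy) z hyz))
    = qpair (comp_ract_z sigma hxy hyz) by exact: qprod_eq.
rewrite /weight121 e2; congr (_ * _ * q _); apply: qprod_eq => /=.
by congr (_, (sval (sigma _)).1); exact: qprod_eq.
Qed.

Lemma weight212E (x y z : A) (hxy : tgt x = src y) (hyz : tgt y = src z) :
  weight212 (@qpair P (qprod A A) A (qpair hxy) z hyz) =
  q (qpair hyz) * q (qpair (comp_x_lact sigma hxy hyz)) *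
  q (qpair (comp_ract_ract sigma hxy hyz)).
Proof.
set t := @qpair P (qprod A A) A (qpair hxy) z hyz.
have e1 : snd_pair t = qpair hyz by exact: qprod_eq.
have e2 : fst_pair (qbraid23 sigma t) = qpair (comp_x_lact sigma hxy hyz).
  by apply: qprod_eq => /=; congr (_, (sval (sigma _)).1); exact: qprod_eq.
rewrite /weight212 e1 e2; congr (_ * _ * q _); apply: qprod_eq => /=.
congr (_, _).
  congr (sval (sigma _)).2; exact: e2.
by congr (sval (sigma _)).2; exact: qprod_eq.
Qed.

End Braid.

Theorem lemma4p2 (K : fieldType) (P : Type) (P_nonempty : inhabited P)
    (A : quiver P) (sigma : qhom (qprod A A) (qprod A A))
    (sigma_iso : bijective sigma)
    (q : qprod A A -> K) (q_neq0 : forall xy, q xy != 0) :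
  braid_solution (twist sigma q) <->
  (braided_quiver sigma /\
   forall (x y z : A) (hxy : tgt x = src y) (hyz : tgt y = src z),
     q (qpair hxy) * q (qpair (comp_ract_z sigma hxy hyz)) *
       q (qpair (comp_lact_lact sigma hxy hyz)) =
     q (qpair hyz) * q (qpair (comp_x_lact sigma hxy hyz)) *
       q (qpair (comp_ract_ract sigma hxy hyz))).
Proof.
split=> [[_ braid]|[braid qE]].
  have eq3 t : qbraid12 sigma (qbraid23 sigma (qbraid12 sigma t)) =
      qbraid23 sigma (qbraid12 sigma (qbraid23 sigma t)) /\
      weight121 sigma q t = weight212 sigma q t.
    (* Each triple is homogeneous for its own source and end, so the braid equation in that degree
       applies to it. *)
    pose z : qarrows _ (src t) (tgt t) := exist _ t (conj erefl erefl).
    have := braid _ _ (kbasis3 K z); rewrite braid121_basis braid212_basis.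
    have w0 : weight121 sigma q t != 0 by rewrite !mulf_neq0.
    by case/(kbasis3_monomial_inj w0) => /(congr1 sval).
  split=> [t|x y z hxy hyz]; first exact: (eq3 t).1.
  by rewrite -weight121E -weight212E (eq3 _).2.
split; first exact: twist_invertible.
have wE t : weight121 sigma q t = weight212 sigma q t.
  case: t => [[[[x y] hxy] z] hyz].
  by have := qE x y z hxy hyz; rewrite -weight121E -weight212E.
(* Both sides are linear, so agreement on the vectors [kbasis3 K z] suffices. *)
move=> p r; apply: (kbasis3_ext
  (f := braid12 (twist sigma q) p r \o braid23 (twist sigma q) p r \o
        braid12 (twist sigma q) p r)
  (g := braid23 (twist sigma q) p r \o braid12 (twist sigma q) p r \o
        braid23 (twist sigma q) p r)) => z.
apply: (etrans (braid121_basis sigma q z)).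
apply: (etrans _ (esym (braid212_basis sigma q z))); rewrite wE.
congr (_ *: kbasis3 K _).
by apply: qarrows_eq; exact: braid.
Qed.
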